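(* Let $\kappa$ be a regular uncountable cardinal such that $\square(\kappa)$ holds and $\kappa^{<\kappa}=\kappa$. Then for every stationary $S\in J_\omega[\kappa]$, $\boxtimes^-(S)$ holds.
   Context: For a set $x$ of ordinals, $\mathrm{acc}(x)=\{\alpha\in x\mid\sup(x\cap\alpha)=\alpha>0\}$ and $\mathrm{nacc}(x)=x\setminus\mathrm{acc}(x)$. A $C$-sequence over $\kappa$ is $\langle C_\alpha\mid\alpha<\kappa\rangle$ where each $C_\alpha$ is a closed subset of $\alpha$ with $\sup(C_\alpha)=\sup(\alpha)$; it is coherent if $C_{\bar\alpha}=C_\alpha\cap\bar\alpha$ for all $\alpha<\kappa$ and $\bar\alpha\in\mathrm{acc}(C_\alpha)$. $\square(\kappa)$ asserts the existence of a coherent $C$-sequence over $\kappa$ such that there is no club $D\subseteq\kappa$ with $D\cap\alpha=C_\alpha$ for all $\alpha\in\mathrm{acc}(D)$. For stationary $S\subseteq\kappa$, $\boxtimes^-(S)$ asserts the existence of a coherent $C$-sequence $\langle C_\alpha\mid\alpha<\kappa\rangle$ such that for every cofinal $A\subseteq\kappa$ there is a nonzero $\alpha\in S$ with $\sup(\mathrm{nacc}(C_\alpha)\cap A)=\alpha$. $J_\omega[\kappa]$ is the collection of all $S\subseteq\kappa$ for which there exist a club $C\subseteq\kappa$ and functions $f_i:\kappa\to[\kappa]^{<\omega}$ ($i<\kappa$) such that for every $\alpha\in S\cap C$, every regressive $f:\alpha\to\alpha$ and every cofinal $B\subseteq\alpha$, there is $i<\alpha$ with $\sup\{\beta\in B\mid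 f(\beta)\in f_i(\beta)\}=\alpha$. *)

(* Defs.v *)
(* Ordinals below kappa are modelled as the elements of a type K
   carrying a strict well-order lt whose order type is kappa. *)
From Stdlib Require Import List.

Section Defs.
Context {K : Type} (lt : K -> K -> Prop).

Definition le (x y : K) : Prop := lt x y \/ x = y.

Definition strict_well_order : Prop :=
  (forall x, ~ lt x x) /\
  (forall x y z, lt x y -> lt y z -> lt x z) /\
  (forall x y, lt x y \/ x = y \/ lt y x) /\
  well_founded lt.

Definition below (a : K) : K -> Prop := fun b => lt b a.

Definition nonzero (a : K) : Prop := exists b, lt b a.

Definition is_sup (X : K -> Prop) (g : K) : Prop :=
  (forall x, X x -> le x g) /\ (forall d, lt d g -> exists x, X x /\ lt d x).

Definition inter (X Y : K -> Prop) : K -> Prop := fun b => X b /\ Y b.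

Definition acc (X : K -> Prop) (a : K) : Prop :=
  X a /\ nonzero a /\ is_sup (inter X (below a)) a.
Definition nacc (X : K -> Prop) (a : K) : Prop := X a /\ ~ acc X a.

Definition closed_subset_of (C : K -> Prop) (a : K) : Prop :=
  (forall b, C b -> lt b a) /\
  (forall g, lt g a -> nonzero g -> is_sup (inter C (below g)) g -> C g).

(* sup(X) = sup(Y) (for bounded X, Y, whose sups lie in K) *)
Definition same_sup (X Y : K -> Prop) : Prop :=
  forall g, is_sup X g <-> is_sup Y g.

Definition C_sequence (C : K -> K -> Prop) : Prop :=
  forall a, closed_subset_of (C a) a /\ same_sup (C a) (below a).

Definition coherent (C : K -> K -> Prop) : Prop :=
  C_sequence C /\
  forall a ab, acc (C a) ab -> forall b, C ab b <-> (C a b /\ lt b ab).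

Definition unbounded (A : K -> Prop) : Prop := forall a, exists b, A b /\ le a b.

Definition club (D : K -> Prop) : Prop :=
  unbounded D /\ (forall g, nonzero g -> is_sup (inter D (below g)) g -> D g).

Definition stationary (S : K -> Prop) : Prop :=
  forall D, club D -> exists a, S a /\ D a.

Definition square : Prop :=
  exists C, coherent C /\
    ~ (exists D, club D /\ forall a, acc D a -> forall b, (D b /\ lt b a) <-> C a b).

Definition boxtimes_minus (S : K -> Prop) : Prop :=
  exists C, coherent C /\
    forall A, unbounded A ->
      exists a, S a /\ nonzero a /\ is_sup (inter (nacc (C a)) A) a.

(* S in J_omega[kappa]; finite subsets of kappa are given as lists *)
Definition J_omega (S : K -> Prop) : Prop :=
  exists (C : K -> Prop) (F : K -> K -> list K), club C /\
    forall a, S a -> C a ->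
      forall f : K -> K,
        (forall b, lt b a -> lt (f b) a) ->
        (forall b, lt b a -> nonzero b -> lt (f b) b) ->
        forall B : K -> Prop,
          (forall b, B b -> lt b a) ->
          (forall g, lt g a -> exists b, B b /\ le g b) ->
          exists i, lt i a /\
            is_sup (fun b => B b /\ In (f b) (F i b)) a.

End Defs.

Definition injects (A B : Type) : Prop :=
  exists f : A -> B, forall x y, f x = f y -> x = y.

Definition is_cardinal {K : Type} (lt : K -> K -> Prop) : Prop :=
  forall a : K, ~ injects K {b : K | lt b a}.
Definition regular {K : Type} (lt : K -> K -> Prop) : Prop :=
  forall A : K -> Prop, unbounded lt A -> injects K {b : K | A b}.
Definition uncountable (K : Type) : Prop := ~ injects K nat.

Definition small_powers {K : Type} (lt : K -> K -> Prop) : Prop :=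
  forall a : K, injects ({b : K | lt b a} -> K) K.

(* Main.v *)
(** There are two steps: club guessing, then guessing of arbitrary cofinal sets.

    For a club D, let C^D_a = { max (D ∩ [0,h]) | h in C_a } (a tail of C_a when D is bounded
    in a); this keeps coherence.  Some D makes the sets nacc(C^D_a) guess clubs at points of S.
    Otherwise fix a0 with uncountably many predecessors (diagonalisation shows that J_omega
    contains no stationary set if there is no such a0) and build a decreasing chain of clubs D_i,
    i < a0, where D_j lies in a club that refutes D_i for every i < j.  Let a in S be a limit of
    D = D_a0.  Then nacc(C^{D_i}_a) ∩ D_j is bounded below a for i < j, and by uncountability of
    a0 one bound b < a serves infinitely many i.  For h in C_a the points max (D_i ∩ [0,h])
    decrease with i, so two of them coincide; this forces D ∩ (b,a) to be a subset of C_a.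
    Pressing down on b yields a thread through C, which is impossible.

    Now let C guess clubs, and let code_x encode functions from x to kappa by ordinals.  Let C^i
    arise from C by inserting, between consecutive points x < y of each C_a with i < x, the finitely
    many values g(i) in (x,y) for which code_x(g) belongs to F_i(y).  If each C^i failed on some
    cofinal set A_i, let g_x(j) be an element of A_j above x.  At points y of a suitable
    club, code_x(g_x) < y for all x < y, so y |-> code_x(g_x), with x the predecessor of y in C_a,
    is regressive; J_omega yields an i for which C^i catches A_i cofinally, a contradiction. *)
Require Import Defs.
From Stdlib Require Import List.
From Stdlib Require Import Classical IndefiniteDescription FunctionalExtensionality.
From Stdlib Require Import ProofIrrelevance Lia.

(** * Choice, finite and countable sets *)

Lemma choice_of {A B : Type} (R : A -> B -> Prop) :
  (forall x, exists y, R x y) -> exists f, forall x, R x (f x).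
Proof.
  intros H. exists (fun x => proj1_sig (constructive_indefinite_description _ (H x))).
  intros x. exact (proj2_sig (constructive_indefinite_description _ (H x))).
Qed.

Definition finite {A : Type} (X : A -> Prop) : Prop := exists l, forall x, X x -> In x l.

Definition countable {A : Type} (X : A -> Prop) : Prop :=
  exists e : A -> nat, forall x y, X x -> X y -> e x = e y -> x = y.

Lemma finite_image {A B : Type} (R : A -> B -> Prop) (l : list A) :
  (forall x y z, R x y -> R x z -> y = z) ->
  finite (fun y => exists x, In x l /\ R x y).
Proof.
  intros HR. induction l as [|a l [m Hm]].
  - exists nil. intros y (x & [] & _).
  - destruct (classic (exists y, R a y)) as [[y Hy]|Hno].
    + exists (y :: m). intros z (x & [<-|Hx] & Hz).
      * left. eauto.
      * right. eauto.
    + exists m. intros z (x & [<-|Hx] & Hz); [destruct Hno|]; eauto.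
Qed.

Lemma finite_level {A : Type} (X : A -> Prop) (e : A -> nat) (n : nat) :
  (forall x y, X x -> X y -> e x = e y -> x = y) ->
  finite (fun x => X x /\ e x <= n).
Proof.
  intros He.
  destruct (finite_image (fun k x => X x /\ e x = k) (seq 0 (S n))) as [l Hl].
  - intros k x y [Hx <-] [Hy E]. auto.
  - exists l. intros x [Hx Hn]. apply Hl. exists (e x). rewrite in_seq.
    repeat split; auto; lia.
Qed.

Lemma finite_enumeration {A : Type} (X : A -> Prop) :
  finite X -> exists l, NoDup l /\ forall x, In x l <-> X x.
Proof.
  intros [l Hl]. revert X Hl. induction l as [|a l IH]; intros X Hl.
  - exists nil. split; [constructor|]. intros x. split; [intros []|apply Hl].
  - destruct (IH (fun x => X x /\ x <> a)) as (m & Hm & Hin).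
    { intros x [Hx Hne]. destruct (Hl x Hx); [congruence|assumption]. }
    destruct (classic (X a)) as [Ha|Ha].
    + exists (a :: m). split.
      * constructor; [|assumption]. rewrite Hin. tauto.
      * intros x. simpl. rewrite Hin. destruct (classic (x = a)) as [->|Hne]; [tauto|].
        intuition congruence.
    + exists m. split; [assumption|]. intros x. rewrite Hin.
      split; [tauto|]. intros Hx. split; [assumption|]. intros ->. tauto.
Qed.

(** Counting predecessors within [X] is injective: if [R x y], the segment of [y] contains [x]
    together with the segment of [x]. *)
Lemma countable_of_finite_segments {A : Type} (X : A -> Prop) (R : A -> A -> Prop) :
  (forall x, ~ R x x) -> (forall x y z, R x y -> R y z -> R x z) ->
  (forall x y, X x -> X y -> R x y \/ x = y \/ R y x) ->
  (forall x, X x -> finite (fun y => X y /\ R y x)) ->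
  countable X.
Proof.
  intros Hirr Htr Htot Hfin.
  assert (HL : forall x, exists l, X x -> NoDup l /\ forall y, In y l <-> X y /\ R y x).
  { intros x. destruct (classic (X x)) as [Hx|Hx].
    - destruct (finite_enumeration _ (Hfin x Hx)) as [l Hl]. exists l. auto.
    - exists nil. tauto. }
  destruct (choice_of _ HL) as [seg Hseg].
  assert (Hlt : forall x y, X x -> X y -> R x y -> length (seg x) < length (seg y)).
  { intros x y Hx Hy Hxy.
    destruct (Hseg x Hx) as [Nx Ix], (Hseg y Hy) as [Ny Iy].
    change (length (x :: seg x) <= length (seg y)). apply NoDup_incl_length.
    - constructor; [|assumption]. rewrite Ix. intros [_ H]. exact (Hirr _ H).
    - intros z [<-|Hz]; rewrite Iy; [auto|]. rewrite Ix in Hz. destruct Hz. eauto. }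
  exists (fun x => length (seg x)). intros x y Hx Hy E.
  destruct (Htot x y Hx Hy) as [H|[H|H]]; [|assumption|];
    apply Hlt in H; auto; lia.
Qed.

(** * Well-orders, suprema, limit points and clubs *)

Section WellOrder.
Context {K : Type} (lt : K -> K -> Prop) (WO : strict_well_order lt).
Local Infix "<" := lt.
Local Notation "x <= y" := (le lt x y).

Lemma lt_irrefl x : ~ x < x.
Proof. apply WO. Qed.

Lemma lt_trans x y z : x < y -> y < z -> x < z.
Proof. apply WO. Qed.

Lemma lt_total x y : x < y \/ x = y \/ y < x.
Proof. apply WO. Qed.

Lemma not_lt x y : ~ x < y -> y <= x.
Proof. unfold le. destruct (lt_total x y) as [|[|]]; auto. tauto. Qed.

Lemma not_le x y : ~ x <= y -> y < x.
Proof. unfold le. destruct (lt_total x y) as [|[|]]; tauto. Qed.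

Ltac order :=
  repeat match goal with
    | H : ~ (_ < _) |- _ => apply not_lt in H
    | H : ~ (_ <= _) |- _ => apply not_le in H
    end;
  match goal with
    | |- ?x < ?y => let H := fresh in apply NNPP; intros H; apply not_lt in H
    | |- ?x <= ?y => let H := fresh in apply NNPP; intros H; apply not_le in H
    | |- ?x = ?y => destruct (lt_total x y) as [|[|]]; [exfalso|assumption|exfalso]
    | |- ~ _ => intro
    | |- False => idtac
    | _ => exfalso
  end;
  repeat match goal with
    | H : _ <= _ |- _ => destruct H as [H|H]; [|try rewrite H in *; clear H]
    | H : lt ?x ?x |- _ => destruct (lt_irrefl x H)
    end;
  repeat match goal with
    | H : ?x < ?y, H' : ?y < ?z |- _ =>
        lazymatch goal with
        | _ : x < z |- _ => fail
        | _ => assert (x < z) by exact (lt_trans x y z H H')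
        end
    | H : lt ?x ?x |- _ => destruct (lt_irrefl x H)
    end; fail.

Lemma lt_least (X : K -> Prop) :
  (exists x, X x) -> exists x, X x /\ forall y, X y -> x <= y.
Proof.
  intros [x Hx]. apply NNPP. intros Hno.
  assert (forall z, ~ X z) as H.
  { intros z. destruct WO as (_ & _ & _ & wf). induction (wf z) as [z _ IH]. intros Hz.
    apply Hno. exists z. split; [assumption|]. intros y Hy. apply not_lt.
    intros Hlt. exact (IH y Hlt Hy). }
  exact (H x Hx).
Qed.

(** The condition sup(X ∩ a) = a > 0 from acc, without membership of [a] in [X]. *)
Definition limit_point (X : K -> Prop) (a : K) : Prop :=
  nonzero lt a /\ forall d, d < a -> exists x, X x /\ d < x /\ x < a.

Definition is_limit : K -> Prop := limit_point (fun _ => True).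

Lemma limit_point_mono (X Y : K -> Prop) a :
  (forall x, x < a -> X x -> Y x) -> limit_point X a -> limit_point Y a.
Proof.
  intros H [Hn HX]. split; [assumption|]. intros d Hd.
  destruct (HX d Hd) as (x & Hx & ? & ?). exists x. auto.
Qed.

Lemma limit_point_iff X Y a :
  (forall x, x < a -> (X x <-> Y x)) -> (limit_point X a <-> limit_point Y a).
Proof. intros H. split; apply limit_point_mono; intros x Hx; apply H; assumption. Qed.

Lemma limit_point_is_limit X a : limit_point X a -> is_limit a.
Proof. apply limit_point_mono. auto. Qed.

Lemma limit_point_above X a d : d < a ->
  (forall e, d <= e -> e < a -> exists x, X x /\ e < x /\ x < a) -> limit_point X a.
Proof.
  intros Hd H. split; [exists d; assumption|]. intros e He.
  destruct (classic (e < d)) as [Hed|Hed].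
  - destruct (H d) as (x & ? & ? & ?); [right; reflexivity|assumption|].
    exists x. repeat split; auto. order.
  - destruct (H e) as (x & ? & ? & ?); [order|assumption|]. exists x. auto.
Qed.

Lemma is_sup_limit_point X a : (forall x, X x -> x < a) -> nonzero lt a ->
  (is_sup lt X a <-> limit_point X a).
Proof.
  intros HX Hn. split.
  - intros [_ H]. split; [assumption|]. intros d Hd. destruct (H d Hd) as (x & ? & ?).
    exists x. auto.
  - intros [_ H]. split; [left; auto|]. intros d Hd. destruct (H d Hd) as (x & ? & ? & ?).
    exists x. auto.
Qed.

Lemma is_sup_inter_below X a : nonzero lt a ->
  (is_sup lt (inter X (below lt a)) a <-> limit_point X a).
Proof.
  intros Hn. rewrite is_sup_limit_point; [|intros x []; assumption|assumption].
  split; apply limit_point_mono; unfold inter, below; intuition.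
Qed.

Lemma acc_iff X a : acc lt X a <-> X a /\ limit_point X a.
Proof.
  unfold acc. split.
  - intros (H1 & H2 & H3). split; [assumption|]. apply is_sup_inter_below; assumption.
  - intros (H1 & H2). split; [assumption|]. assert (H3 := proj1 H2).
    split; [assumption|]. apply is_sup_inter_below; assumption.
Qed.

Lemma nacc_iff X a : nacc lt X a <-> X a /\ ~ limit_point X a.
Proof. unfold nacc. rewrite acc_iff. tauto. Qed.

Lemma nacc_ext X Y a : (forall x, X x <-> Y x) -> nacc lt X a -> nacc lt Y a.
Proof.
  intros H. rewrite !nacc_iff, <- H. intros [Ha Hlp]. split; [assumption|].
  contradict Hlp. apply limit_point_iff with (Y := Y); auto.
Qed.

Lemma club_iff D :
  club lt D <-> unbounded lt D /\ forall g, limit_point D g -> D g.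
Proof.
  unfold club. split; intros [H1 H2]; (split; [assumption|]); intros g.
  - intros Hg. apply H2; [apply Hg|]. apply is_sup_inter_below; [apply Hg|assumption].
  - intros Hn Hg. apply H2. apply is_sup_inter_below; assumption.
Qed.

Lemma club_ext D E : (forall x, D x <-> E x) -> club lt D -> club lt E.
Proof.
  intros H HD. apply club_iff in HD. apply club_iff. destruct HD as [Hu Hcl]. split.
  - intros a. destruct (Hu a) as (b & Hb & Hab). exists b. split; [apply H|]; assumption.
  - intros g Hg. apply H, Hcl. apply limit_point_iff with (Y := E); auto.
Qed.

Lemma finite_not_limit_point X a : finite (fun x => X x /\ x < a) -> ~ limit_point X a.
Proof.
  intros [l Hl] [[z Hz] H].
  assert (HB : forall m, exists d, d < a /\ forall x, In x m -> x < a -> x <= d).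
  { induction m as [|y m (d & Hd & Hm)].
    - exists z. split; [assumption|]. intros x [].
    - destruct (classic (d < y /\ y < a)) as [[Hy1 Hy2]|Hy].
      + exists y. split; [assumption|]. intros x [<-|Hx] Hxa; [right; reflexivity|].
        specialize (Hm x Hx Hxa). order.
      + exists d. split; [assumption|]. intros x [<-|Hx] Hxa; [|auto].
        apply not_lt. tauto. }
  destruct (HB l) as (d & Hd & Hm). destruct (H d Hd) as (x & Hx & Hdx & Hxa).
  specialize (Hm x (Hl x (conj Hx Hxa)) Hxa). order.
Qed.

(* The values descend along increasing indices, so well-foundedness bounds the number of indices. *)
Lemma finite_of_decreasing (I : K -> Prop) (R : K -> K -> Prop) :
  (forall i, I i -> exists v, R i v) ->
  (forall i j v w, I i -> I j -> i < j -> R i v -> R j w -> w < v) ->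
  finite I.
Proof.
  intros Htot Hdec.
  assert (Htail : forall v i, I i -> R i v -> finite (fun k => I k /\ i < k)).
  { intros v. destruct WO as (_ & _ & _ & wf). induction (wf v) as [v _ IH]. intros i Hi Hv.
    destruct (classic (exists j, I j /\ i < j)) as [Hex|Hno].
    - destruct (lt_least _ Hex) as (j & [Hj Hij] & Hmin).
      destruct (Htot j Hj) as [w Hw].
      destruct (IH w (Hdec i j v w Hi Hj Hij Hv Hw) j Hj Hw) as [l Hl].
      exists (j :: l). intros k [Hk Hik].
      destruct (Hmin k (conj Hk Hik)) as [Hjk| ->]; [right; auto|left; reflexivity].
    - exists nil. intros k Hk. destruct Hno. eauto. }
  destruct (classic (exists i, I i)) as [Hex|Hno].
  - destruct (lt_least _ Hex) as (i & Hi & Hmin). destruct (Htot i Hi) as [v Hv].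
    destruct (Htail v i Hi Hv) as [l Hl]. exists (i :: l). intros k Hk.
    destruct (Hmin k Hk) as [Hik| ->]; [right; auto|left; reflexivity].
  - exists nil. intros k Hk. destruct Hno. eauto.
Qed.

Lemma sup_exists (X : K -> Prop) b : (forall x, X x -> x <= b) ->
  exists u, u <= b /\ (forall x, X x -> x <= u) /\ forall d, d < u -> exists x, X x /\ d < x.
Proof.
  intros Hb. destruct (lt_least (fun u => forall x, X x -> x <= u)) as (u & Hu & Hmin);
    [exists b; assumption|].
  exists u. split; [auto|]. split; [assumption|]. intros d Hd. apply NNPP. intros Hno.
  assert (u <= d); [|order]. apply Hmin. intros x Hx. apply not_lt. intros Hdx. eauto.
Qed.

Lemma limit_or_max X u : nonzero lt u -> ~ limit_point X u ->
  (exists d, d < u /\ forall x, X x -> x < u -> x <= d).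
Proof.
  intros Hn H. apply NNPP. intros Hno. apply H. split; [assumption|]. intros d Hd.
  apply NNPP. intros Hno'. apply Hno. exists d. split; [assumption|]. intros x Hx Hxu.
  apply not_lt. intros Hdx. apply Hno'. eauto.
Qed.

(** x = max (D ∩ [0,h]), as a relation because the maximum may fail to exist. *)
Definition last_below (D : K -> Prop) (h x : K) : Prop :=
  D x /\ x <= h /\ forall y, D y -> y <= h -> y <= x.

(** The supremum of D ∩ [0,h] lies in [D], being otherwise a limit point of it. Closure is asked
    only up to [h], so that a ladder, closed only below its index, also qualifies. *)
Lemma last_below_exists D h y : (forall g, g <= h -> limit_point D g -> D g) ->
  D y -> y <= h -> exists x, last_below D h x.
Proof.
  intros Hcl Hy Hyh.
  destruct (sup_exists (fun x => D x /\ x <= h) h) as (u & Huh & Hub & Hsup); [tauto|].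
  exists u. split; [|split; [assumption|intros; apply Hub; auto]].
  apply NNPP. intros HDu. apply HDu. apply Hcl; [assumption|].
  assert (Hyu : y < u).
  { destruct (Hub y (conj Hy Hyh)) as [| ->]; [assumption|contradiction]. }
  split; [exists y; assumption|]. intros d Hd.
  destruct (Hsup d Hd) as (x & [Hx Hxh] & Hdx). exists x. split; [assumption|].
  split; [assumption|]. destruct (Hub x (conj Hx Hxh)) as [| ->]; [assumption|contradiction].
Qed.

(** * Ladder systems and coherent C-sequences *)

(** A coherent C-sequence seen only at limits: closure and coherence merge into one clause on the
    limit points below [a]. *)
Definition ladder_system (L : K -> K -> Prop) : Prop :=
  forall a, is_limit a ->
    (forall b, L a b -> b < a) /\ limit_point (L a) a /\
    forall g, g < a -> limit_point (L a) g -> L a g /\ forall b, L g b <-> L a b /\ b < g.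

(* Ladder systems are only constrained at limits; [complete] installs the forced values elsewhere. *)
Definition complete (L : K -> K -> Prop) (a b : K) : Prop :=
  is_limit a /\ L a b \/ ~ is_limit a /\ b < a /\ ~ exists y, b < y /\ y < a.

Lemma complete_limit L a b : is_limit a -> (complete L a b <-> L a b).
Proof. unfold complete. tauto. Qed.

Lemma complete_coherent L : ladder_system L -> coherent lt (complete L).
Proof.
  intros HL.
  (* At a non-limit [a], only an immediate predecessor of [a] belongs to [complete L a], which
     leaves no room for a limit point below [a]. *)
  assert (Hsucc : forall a g, ~ is_limit a -> limit_point (complete L a) g -> g < a -> False).
  { intros a g Ha [[z Hz] Hg] Hga. destruct (Hg z Hz) as (x & Hx & _ & Hxg).
    destruct Hx as [[]|(_ & _ & Hno)]; [contradiction|]. apply Hno. eauto. }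
  split.
  - intros a. split.
    + destruct (classic (is_limit a)) as [Ha|Ha].
      * destruct (HL a Ha) as (Hsub & _ & Hcl). split.
        { intros b. rewrite complete_limit by assumption. auto. }
        intros g Hga Hn Hg. apply is_sup_inter_below in Hg; [|assumption].
        rewrite complete_limit by assumption. refine (proj1 (Hcl g Hga _)).
        eapply limit_point_iff; [|exact Hg]. intros x _.
        rewrite complete_limit by assumption. reflexivity.
      * split; [unfold complete; tauto|]. intros g Hga Hn Hg.
        apply is_sup_inter_below in Hg; [|assumption]. destruct (Hsucc a g Ha Hg Hga).
    + assert (Hub : forall d, d < a -> exists x, complete L a x /\ d <= x).
      { intros d Hd. destruct (classic (is_limit a)) as [Ha|Ha].
        - destruct (HL a Ha) as (_ & Hlp & _). destruct (proj2 Hlp d Hd) as (x & Hx & Hdx & _).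
          exists x. split; [apply complete_limit; assumption|left; assumption].
        - destruct (limit_or_max (fun _ => True) a (ex_intro _ d Hd) Ha) as (m & Hma & Hm).
          exists m. split; [|auto]. right. split; [assumption|]. split; [assumption|].
          intros (y & Hmy & Hya). assert (y <= m) by auto. order. }
      assert (Hlt : forall x, complete L a x -> x < a).
      { intros x [[Ha Hx]|(_ & Hx & _)]; [|assumption]. exact (proj1 (HL a Ha) x Hx). }
      intros g. split; intros [H1 H2]; split.
      * intros x Hx. destruct (Hub x Hx) as (y & Hy & Hxy). specialize (H1 y Hy). order.
      * intros d Hd. destruct (H2 d Hd) as (x & Hx & Hdx). exists x. split; [apply Hlt|]; assumption.
      * intros x Hx. apply H1. apply Hlt. assumption.
      * intros d Hd. destruct (H2 d Hd) as (x & Hx & Hdx). destruct (Hub x Hx) as (y & Hy & Hxy).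
        exists y. split; [assumption|]. order.
  - intros a g Hg b. apply acc_iff in Hg. destruct Hg as [Hg Hlp].
    destruct (classic (is_limit a)) as [Ha|Ha].
    + rewrite complete_limit by (eapply limit_point_is_limit; eassumption).
      rewrite (complete_limit L a) by assumption. rewrite complete_limit in Hg by assumption.
      destruct (HL a Ha) as (Hsub & _ & Hcl). refine (proj2 (Hcl g (Hsub g Hg) _) b).
      eapply limit_point_iff; [|exact Hlp]. intros x _.
      rewrite complete_limit by assumption. reflexivity.
    + destruct (Hsucc a g Ha Hlp). destruct Hg as [[]|]; tauto.
Qed.

Lemma coherent_ladder_system C : coherent lt C -> ladder_system C.
Proof.
  intros [HC Hcoh] a Ha. destruct (HC a) as [[Hsub Hcl] Hsup].
  split; [assumption|]. split.
  - apply is_sup_limit_point; [assumption|apply Ha|]. apply Hsup.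
    apply is_sup_limit_point; [auto|apply Ha|].
    eapply limit_point_mono; [|exact Ha]. auto.
  - intros g Hga Hg.
    assert (HCg : C a g).
    { apply Hcl; [assumption|apply Hg|]. apply is_sup_inter_below; [apply Hg|assumption]. }
    split; [assumption|]. apply Hcoh. apply acc_iff. auto.
Qed.

(** * Retracting a ladder system to a club *)

(** The C^D_a of the overview. In the second case the tail starts above all of D ∩ a, so its limit
    points are not limit points of [D] and fall under the same case. *)
Definition retract (D : K -> Prop) (L : K -> K -> Prop) (a x : K) : Prop :=
  limit_point D a /\ (exists h, L a h /\ last_below D h x) \/
  ~ limit_point D a /\ L a x /\ forall d, D d -> d < a -> d < x.

(** A retract x < g comes from a point h < g of the ladder with x <= h: since [g] is in [D], any h
    >= g would retract to a point >= g. *)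
Lemma retract_limit_point D L a g : ladder_system L -> limit_point D a ->
  (forall g, limit_point D g -> D g) -> g < a ->
  limit_point (retract D L a) g -> limit_point (L a) g /\ limit_point D g.
Proof.
  intros HL HDa HD Hga Hg.
  assert (Hx : forall x, retract D L a x -> exists h, L a h /\ last_below D h x).
  { intros x [[_ H]|[H _]]; [assumption|contradiction]. }
  assert (HDg : limit_point D g).
  { eapply limit_point_mono; [|exact Hg]. intros x _ Hr.
    destruct (Hx x Hr) as (h & _ & ? & _). assumption. }
  split; [|assumption]. split; [apply Hg|]. intros d Hd.
  destruct (proj2 Hg d Hd) as (x & Hr & Hdx & Hxg).
  destruct (Hx x Hr) as (h & Hh & HDx & Hxh & Hmax). exists h.
  split; [assumption|]. split; [order|]. apply NNPP. intros Hgh.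
  assert (g <= x); [|order]. apply Hmax; [auto|order].
Qed.

Lemma retract_ladder_system D L :
  club lt D -> ladder_system L -> ladder_system (retract D L).
Proof.
  intros HD HL a Ha. apply club_iff in HD. destruct HD as [_ HD].
  destruct (HL a Ha) as (Hsub & Hcof & Hcoh).
  destruct (classic (limit_point D a)) as [HDa|HDa].
  - split; [|split].
    + intros b [[_ (h & Hh & _ & Hbh & _)]|[? _]]; [|contradiction].
      specialize (Hsub h Hh). order.
    + split; [apply Ha|]. intros d Hd.
      destruct (proj2 HDa d Hd) as (y & Hy & Hdy & Hya).
      destruct (proj2 Hcof y Hya) as (h & Hh & Hyh & Hha).
      destruct (last_below_exists D h y) as (x & Hx); [auto|assumption|left; assumption|].
      exists x. split; [left; split; [assumption|eauto]|].
      destruct Hx as (_ & Hxh & Hmax). assert (y <= x) by (apply Hmax; [|left]; assumption).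
      split; order.
    + intros g Hga Hg.
      destruct (retract_limit_point D L a g HL HDa HD Hga Hg) as [HLg HDg].
      destruct (Hcoh g Hga HLg) as [HLag Heq]. split.
      (* Lying in both [L a] and [D], the point [g] is its own retract. *)
      * left. split; [assumption|]. exists g. split; [assumption|].
        split; [auto|]. split; [right; reflexivity|]. auto.
      * intros b. split.
        { intros [[_ (h & Hh & Hb)]|[? _]]; [|contradiction]. apply Heq in Hh.
          destruct Hh as [Hh Hhg]. split; [left; eauto|]. destruct Hb as (_ & ? & _). order. }
        { intros [[[_ (h & Hh & Hb)]|[? _]] Hbg]; [|contradiction]. left. split; [assumption|].
          exists h. split; [|assumption]. apply Heq. split; [assumption|].
          apply NNPP. intros Hgh. destruct Hb as (_ & _ & Hmax).
          assert (g <= b); [|order]. apply Hmax; [auto|order]. }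
  - split; [|split].
    + intros b [[? _]|(_ & Hb & _)]; [contradiction|auto].
    + destruct (limit_or_max D a (proj1 Ha) HDa) as (m & Hma & Hm).
      apply limit_point_above with m; [assumption|]. intros e Hme He.
      destruct (proj2 Hcof e He) as (x & Hx & Hex & Hxa). exists x. split; [|auto].
      right. split; [assumption|]. split; [assumption|]. intros d Hd Hda.
      specialize (Hm d Hd Hda). order.
    + intros g Hga Hg.
      assert (Hx : forall x, retract D L a x -> L a x /\ forall d, D d -> d < a -> d < x).
      { intros x [[? _]|[_ H]]; [contradiction|assumption]. }
      assert (HLg : limit_point (L a) g).
      { eapply limit_point_mono; [|exact Hg]. intros x _ Hr. apply Hx. assumption. }
      destruct (Hcoh g Hga HLg) as [HLag Heq].
      assert (HDlow : exists x, x < g /\ forall d, D d -> d < a -> d < x).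
      { destruct (proj1 Hg) as [z Hz]. destruct (proj2 Hg z Hz) as (x & Hr & _ & Hxg).
        exists x. split; [assumption|]. apply Hx. assumption. }
      destruct HDlow as (x0 & Hx0g & Hx0).
      assert (HDg : ~ limit_point D g).
      { intros [_ H]. destruct (H x0 Hx0g) as (d & Hd & Hxd & Hdg).
        assert (d < x0) by (apply Hx0; [assumption|order]). order. }
      split.
      * right. split; [assumption|]. split; [assumption|]. intros d Hd Hda.
        specialize (Hx0 d Hd Hda). order.
      * intros b. split.
        { intros [[? _]|(_ & Hb & Hdb)]; [contradiction|]. apply Heq in Hb. destruct Hb as [Hb Hbg].
          split; [|assumption]. right. split; [assumption|]. split; [assumption|].
          intros d Hd Hda. apply Hdb; [assumption|]. specialize (Hx0 d Hd Hda). order. }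
        { intros [Hr Hbg]. destruct (Hx b Hr) as [Hb Hdb]. right. split; [assumption|].
          split; [apply Heq; auto|]. intros d Hd Hdg. apply Hdb; [assumption|order]. }
Qed.


Lemma chain_recursion (E : (K -> Prop) -> K -> Prop) :
  exists D : K -> K -> Prop, forall i, D i = fun x => forall j, j < i -> E (D j) x.
Proof.
  destruct WO as (_ & _ & _ & wf).
  exists (Fix wf (fun _ => K -> Prop) (fun i rec x => forall j (p : j < i), E (rec j p) x)).
  intros i. rewrite Fix_eq; [reflexivity|]. intros x f g Hfg.
  (* An arbitrary [E] respects only equality of predicates, hence functional extensionality. *)
  replace f with g; [reflexivity|].
  apply functional_extensionality_dep. intros y.
  apply functional_extensionality_dep. intros p. symmetry. apply Hfg.
Qed.

(** * Clubs and stationary sets on a regular uncountable cardinal *)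

Section Regular.
Context (Hcard : is_cardinal lt) (Hreg : regular lt) (Hunc : uncountable K).

(** By regularity [K] injects into an unbounded range; choosing preimages then injects [K] into
    [J]. *)
Lemma bounded_range {J : Type} (f : J -> K) : ~ injects K J -> exists u, forall j, f j < u.
Proof.
  intros HJ. apply NNPP. intros Hno. apply HJ.
  destruct (Hreg (fun b => exists j, f j = b)) as [h Hh].
  { intros a. apply NNPP. intros Ha. apply Hno. exists a. intros j.
    apply not_le. intros Hj. apply Ha. eauto. }
  destruct (choice_of (fun x j => f j = proj1_sig (h x))) as [g Hg].
  { intros x. exact (proj2_sig (h x)). }
  exists g. intros x y E. apply Hh. apply eq_sig_hprop; [intros; apply proof_irrelevance|].
  rewrite <- !Hg, E. reflexivity.
Qed.

Lemma bounded_family {J : Type} (f : J -> K) :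
  (exists e : J -> nat, forall i j, e i = e j -> i = j) -> exists u, forall j, f j < u.
Proof.
  intros [e He]. apply bounded_range. intros [g Hg]. apply Hunc.
  exists (fun x => e (g x)). intros x y E. auto.
Qed.

Lemma bounded_below (a : K) (f : K -> K) : exists u, forall j, j < a -> f j < u.
Proof.
  destruct (bounded_range (fun j : {j | j < a} => f (proj1_sig j)) (Hcard a)) as [u Hu].
  exists u. intros j Hj. exact (Hu (exist _ j Hj)).
Qed.

Lemma larger_exists (a b : K) : exists u, a < u /\ b < u.
Proof.
  destruct (bounded_family (fun t : bool => if t then a else b)) as [u Hu].
  { exists (fun t : bool => if t then 0 else 1). intros [] []; congruence. }
  exists u. split; [exact (Hu true)|exact (Hu false)].
Qed.

Lemma unbounded_above X a : unbounded lt X -> exists b, X b /\ a < b.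
Proof.
  intros HX. destruct (larger_exists a a) as (c & Hac & _). destruct (HX c) as (b & Hb & Hcb).
  exists b. split; [assumption|order].
Qed.

(** Closing off: the supremum of an omega-sequence whose next term bounds [h] below the current one
    is closed under [h]. *)
Lemma club_closure_points (h : K -> K) : club lt (fun x => forall b, b < x -> h b < x).
Proof.
  apply club_iff. split.
  - intros a.
    destruct (choice_of (fun x y => x < y /\ forall b, b < x -> h b < y)) as [H HH].
    { intros x. destruct (bounded_below x h) as [u Hu]. destruct (larger_exists x u) as (y & ? & ?).
      exists y. split; [assumption|]. intros b Hb. specialize (Hu b Hb). order. }
    set (y := fix y n := match n with O => a | S n => H (y n) end).
    assert (Hy0 : y O = a) by reflexivity.
    assert (HyS : forall n b, b < y n -> h b < y (S n)) by (intros n; apply (HH (y n))).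
    clearbody y.
    destruct (bounded_family y) as [u Hu]; [exists (fun n => n); auto|].
    destruct (sup_exists (fun x => exists n, x = y n) u) as (x & _ & Hub & Hsup).
    { intros z [n ->]. left. apply Hu. }
    exists x. split; [|apply Hub; exists O; symmetry; assumption].
    intros b Hb. destruct (Hsup b Hb) as (z & [n ->] & Hbn).
    assert (Hn : y (S n) <= x) by eauto. specialize (HyS n b Hbn). order.
  - intros g [_ Hg] b Hb. destruct (Hg b Hb) as (x & Hx & Hbx & Hxg).
    specialize (Hx b Hbx). order.
Qed.

Lemma club_limit_points D : unbounded lt D -> club lt (limit_point D).
Proof.
  intros HD. apply club_iff. split.
  - intros a. destruct (choice_of (fun b x => D x /\ b < x)) as [h Hh].
    { intros b. apply unbounded_above. assumption. }
    destruct (unbounded_above _ a (proj1 (club_closure_points h))) as (x & Hx & Hax).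
    exists x. split; [|left; assumption]. split; [exists a; assumption|].
    intros d Hd. exists (h d). destruct (Hh d). auto.
  - intros g Hg. split; [apply Hg|]. intros d Hd. destruct (proj2 Hg d Hd) as (x & Hx & Hdx & Hxg).
    destruct (proj2 Hx d Hdx) as (y & Hy & Hdy & Hyx). exists y. split; [assumption|].
    split; [assumption|order].
Qed.

Lemma club_is_limit : club lt is_limit.
Proof.
  apply club_limit_points. intros a. exists a. split; [constructor|right; reflexivity].
Qed.

Lemma club_above a : club lt (fun x => a < x).
Proof.
  apply club_iff. split.
  - intros b. destruct (larger_exists a b) as (u & Ha & Hb). exists u. split; [|left]; assumption.
  - intros g [[z Hz] H]. destruct (H z Hz) as (x & Hx & _ & Hxg). order.
Qed.

(** Let h(b) exceed some point of every [D j] above [b]. A closure point of [h] is then a limit of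
    all [D j] at once. *)
Lemma club_intersection {J : Type} (D : J -> K -> Prop) :
  ~ injects K J -> (forall j, club lt (D j)) -> club lt (fun x => forall j, D j x).
Proof.
  intros HJ HD. apply club_iff. split.
  - intros a. destruct (choice_of (fun b u => forall j, exists x, D j x /\ b < x /\ x < u)) as [h Hh].
    { intros b. destruct (choice_of (fun j x => D j x /\ b < x)) as [f Hf].
      { intros j. apply unbounded_above. apply HD. }
      destruct (bounded_range f HJ) as [u Hu]. exists u. intros j. exists (f j).
      destruct (Hf j). auto. }
    destruct (unbounded_above _ a (proj1 (club_closure_points h))) as (x & Hx & Hax).
    exists x. split; [|left; assumption]. intros j.
    apply (proj2 (proj1 (club_iff _) (HD j))). split; [exists a; assumption|].
    intros d Hd. destruct (Hh d j) as (y & Hy & Hdy & Hyh). exists y. split; [assumption|].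
    split; [assumption|]. specialize (Hx d Hd). order.
  - intros g Hg j. apply (proj2 (proj1 (club_iff _) (HD j))).
    eapply limit_point_mono; [|exact Hg]. auto.
Qed.

Lemma club_inter D E : club lt D -> club lt E -> club lt (inter D E).
Proof.
  intros HD HE.
  assert (H : club lt (fun x => forall t : bool, (if t then D else E) x)).
  { apply club_intersection.
    - intros [g Hg]. apply Hunc. exists (fun x => if g x then 0 else 1). intros x y H.
      apply Hg. destruct (g x), (g y); congruence.
    - intros []; assumption. }
  apply club_iff in H. destruct H as [Hu Hcl]. apply club_iff. split.
  - intros a. destruct (Hu a) as (b & Hb & Hab). exists b.
    split; [split; [exact (Hb true)|exact (Hb false)]|assumption].
  - intros g Hg. assert (Hb : forall t : bool, (if t then D else E) g).
    { apply Hcl. eapply limit_point_mono; [|exact Hg]. intros x _ [Hx Hx'] []; assumption. }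
    split; [exact (Hb true)|exact (Hb false)].
Qed.

Lemma stationary_inter S D : stationary lt S -> club lt D -> stationary lt (inter S D).
Proof.
  intros HS HD E HE. destruct (HS _ (club_inter D E HD HE)) as (a & Ha & HDa & HEa).
  exists a. repeat split; assumption.
Qed.

(** Fodor's lemma for relations. If each [b] worked only below some h(b), a closure point of [h] in
    [S] would be a contradiction. *)
Lemma pressing_down S (P : K -> K -> Prop) :
  stationary lt S -> (forall a, S a -> exists b, b < a /\ P b a) ->
  exists b, unbounded lt (fun a => S a /\ P b a).
Proof.
  intros HS HP. apply NNPP. intros Hno.
  destruct (choice_of (fun b z => forall a, S a -> P b a -> a < z)) as [h Hh].
  { intros b. apply NNPP. intros Hb. apply Hno. exists b. intros z. apply NNPP. intros Hz.
    apply Hb. exists z. intros a Ha HPa. apply not_le. intros Hza. eauto. }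
  destruct (HS _ (club_closure_points h)) as (a & Ha & Hcl).
  destruct (HP a Ha) as (b & Hb & HPb). specialize (Hh b a Ha HPb). specialize (Hcl b Hb). order.
Qed.

(** * Club guessing, and an uncountable initial segment *)

(** Pressing down fixes one bound [b0] for unboundedly many [a]. For two such a < a', the set D ∩
    (b0,a) is cofinal in [a] and contained in [C a'], so coherence gives C_a = C_a' ∩ a; the union
    of these [C a] is the thread. *)
Lemma thread_of_agreement C D S : coherent lt C -> stationary lt S ->
  (forall a, S a -> limit_point D a /\
    exists b, b < a /\ forall d, D d -> b < d -> d < a -> C a d) ->
  exists T, club lt T /\ forall a, acc lt T a -> forall b, (T b /\ b < a) <-> C a b.
Proof.
  intros HC HS HD. assert (HL := coherent_ladder_system C HC).
  destruct (pressing_down S (fun b a => forall d, D d -> b < d -> d < a -> C a d)) as [b0 Hb0];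
    [assumption|intros a Ha; apply HD; assumption|].
  set (U := fun a => S a /\ b0 < a /\ forall d, D d -> b0 < d -> d < a -> C a d).
  assert (HU : forall z, exists a, U a /\ z < a).
  { intros z. destruct (larger_exists b0 z) as (u & Hbu & Hzu).
    destruct (Hb0 u) as (a & [Ha1 Ha2] & Hua). exists a.
    split; [split; [assumption|split; [order|assumption]]|order]. }
  assert (Hlim : forall a, U a -> is_limit a).
  { intros a (Ha & _). destruct (HD a Ha) as [H _]. eapply limit_point_is_limit. exact H. }
  assert (Hcoh : forall a a', U a -> U a' -> a < a' -> forall b, C a b <-> C a' b /\ b < a).
  { intros a a' Ha Ha' Haa'. apply (HL a' (Hlim a' Ha')); [assumption|].
    destruct Ha as (Ha & Hba & _). destruct Ha' as (_ & _ & Ha').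
    apply limit_point_above with b0; [assumption|]. intros e Hbe He.
    destruct (proj2 (proj1 (HD a Ha)) e He) as (x & Hx & Hex & Hxa).
    exists x. split; [apply Ha'; [assumption|order|order]|auto]. }
  set (T := fun b => exists a, U a /\ C a b).
  assert (HT : forall a, U a -> forall b, b < a -> (T b <-> C a b)).
  { intros a Ha b Hb. split; [|intros H; exists a; auto]. intros (a' & Ha' & Hb').
    destruct (lt_total a a') as [H|[<-|H]].
    - apply (Hcoh a a'); auto.
    - assumption.
    - apply (Hcoh a' a) in Hb'; tauto. }
  assert (Hlp : forall g, limit_point T g -> exists a, U a /\ g < a /\ limit_point (C a) g).
  { intros g Hg. destruct (HU g) as (a & Ha & Hga). exists a.
    split; [assumption|]. split; [assumption|].
    eapply limit_point_mono; [|exact Hg]. intros x Hx HTx. apply HT; [assumption|order|assumption]. }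
  exists T. split.
  - apply club_iff. split.
    + intros z. destruct (HU z) as (a & Ha & Hza).
      destruct (HL a (Hlim a Ha)) as (_ & [_ Hcof] & _). destruct (Hcof z Hza) as (x & Hx & Hzx & _).
      exists x. split; [exists a; auto|left; assumption].
    + intros g Hg. destruct (Hlp g Hg) as (a & Ha & Hga & Hlg). exists a. split; [assumption|].
      exact (proj1 (proj2 (proj2 (HL a (Hlim a Ha))) g Hga Hlg)).
  - intros g Hg b. apply acc_iff in Hg. destruct Hg as [_ Hg].
    destruct (Hlp g Hg) as (a & Ha & Hga & Hlg).
    destruct (HL a (Hlim a Ha)) as (_ & _ & Hcl). destruct (Hcl g Hga Hlg) as [_ Heq].
    rewrite Heq. split; intros [H1 H2]; (split; [|assumption]); apply (HT a Ha); (assumption || order).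
Qed.

Lemma club_guessing C S a0 : coherent lt C ->
  ~ (exists T, club lt T /\ forall a, acc lt T a -> forall b, (T b /\ b < a) <-> C a b) ->
  stationary lt S -> ~ countable (fun b => b < a0) ->
  exists c, ladder_system c /\
    forall E, club lt E -> exists a, S a /\ is_limit a /\ limit_point (inter (nacc lt (c a)) E) a.
Proof.
  intros HC Hno HS Ha0. apply NNPP. intros Hng. apply Hno. clear Hno.
  assert (HL := coherent_ladder_system C HC).
  (* [E D] is a club that [retract D C] fails to guess; on non-clubs the value [D] is a mere
     default. *)
  destruct (choice_of (fun D E => club lt D -> club lt E /\ forall a, S a -> is_limit a ->
      ~ limit_point (inter (nacc lt (retract D C a)) E) a)) as [E HE].
  { intros D. destruct (classic (club lt D)) as [HD|HD]; [|exists D; tauto].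
    apply NNPP. intros HnE. apply Hng. exists (retract D C).
    split; [apply retract_ladder_system; assumption|]. intros E HE. apply NNPP. intros Hna.
    apply HnE. exists E. intros _. split; [assumption|]. intros a Ha Hlim Hlp. eauto. }
  clear Hng. destruct (chain_recursion E) as [D HD].
  assert (Hclub : forall i, club lt (D i)).
  { intros i. destruct WO as (_ & _ & _ & wf). induction (wf i) as [i _ IH]. rewrite HD.
    assert (H : club lt (fun x => forall j : {j | j < i}, E (D (proj1_sig j)) x)).
    { apply club_intersection; [apply Hcard|]. intros [j Hj]. apply HE. auto. }
    apply club_ext with (2 := H). intros x.
    split; [|intros H' [j Hj]; auto]. intros H' j Hj. exact (H' (exist _ j Hj)). }
  assert (HDE : forall i j x, i < j -> D j x -> E (D i) x).
  { intros i j x Hij Hx. rewrite HD in Hx. auto. }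
  assert (HDD : forall i j x, i < j -> D j x -> D i x).
  { intros i j x Hij Hx. rewrite HD. intros k Hk. apply HDE with j; [order|assumption]. }
  assert (Hcl : forall i g, limit_point (D i) g -> D i g).
  { intros i. apply (proj1 (club_iff _) (Hclub i)). }
  apply (thread_of_agreement C (D a0) (inter S (limit_point (D a0)))); [assumption| |].
  { apply stationary_inter; [assumption|]. apply club_limit_points. apply Hclub. }
  intros a [HSa Hlpa]. split; [assumption|].
  assert (Hlim : is_limit a) by (eapply limit_point_is_limit; eassumption).
  assert (Hbd : forall i, exists b, b < a /\
      forall x, inter (nacc lt (retract (D i) C a)) (E (D i)) x -> x < a -> x <= b).
  { intros i. destruct (HE (D i) (Hclub i)) as [_ H].
    apply limit_or_max; [apply Hlim|]. apply H; assumption. }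
  destruct (choice_of _ Hbd) as [s Hs]. clear Hbd.
  (* Order the indices by the bound [s i], ties by the index. If every bound served finitely many
     indices, all segments would be finite and [a0] would have countably many predecessors. *)
  assert (Hinf : exists b, b < a /\ ~ finite (fun i => i < a0 /\ s i <= b)).
  { apply NNPP. intros Hfin. apply Ha0.
    apply countable_of_finite_segments with (R := fun i j => s i < s j \/ s i = s j /\ i < j).
    - intros x [H|[_ H]]; order.
    - intros x y z [H|[H H']] [G|[G G']]; rewrite ?H, <- ?G; eauto using lt_trans.
    - intros x y _ _. destruct (lt_total (s x) (s y)) as [|[|]]; auto.
      destruct (lt_total x y) as [|[|]]; auto.
    - intros x Hx. destruct (NNPP (finite (fun i => i < a0 /\ s i <= s x))) as [l Hl].
      { intros H. apply Hfin. exists (s x). split; [apply Hs|assumption]. }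
      exists l. intros y [Hy Hyx]. apply Hl. split; [assumption|]. unfold le. tauto. }
  destruct Hinf as (b & Hba & Hinf). exists b. split; [assumption|].
  intros d Hd Hbd Hda. apply NNPP. intros HCd. apply Hinf.
  destruct (HL a Hlim) as (Hsub & [_ Hcof] & HCcl).
  destruct (lt_least (fun h => C a h /\ d <= h)) as (h & [Hh Hdh] & Hmin).
  { destruct (Hcof d Hda) as (h & Hh & Hdh & _). exists h. split; [|left]; assumption. }
  assert (Hlt : d < h) by (destruct Hdh as [| ->]; [assumption|contradiction]).
  (* With [h] the least point of [C a] past the missed [d], the points max (D_i ∩ [0,h]) exist since
     [d] is in every [D i]. Their strict descent would leave finitely many indices. *)
  apply finite_of_decreasing with (R := fun i v => last_below (D i) h v).
  - intros i [Hi _]. apply last_below_exists with d; [auto|eauto|assumption].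
  - intros i j v w [Hi Hsi] [Hj _] Hij (Hv & Hvh & Hvmax) (Hw & Hwh & Hwmax).
    assert (Hwv : w <= v) by (apply Hvmax; eauto).
    destruct Hwv as [|Heq]; [assumption|exfalso]. subst w.
    assert (Hdv : d <= v) by (apply Hvmax; eauto).
    specialize (Hsub h Hh). assert (Hva : v < a) by order.
    assert (HDa : limit_point (D i) a).
    { eapply limit_point_mono; [|exact Hlpa]. eauto. }
    destruct (Hs i) as [_ Hsmax].
    (* A repeated value [v] lies in [D j], hence in [E (D i)], and beyond the bound [s i]; so it is
       not in the nacc of the retract. *)
    assert (Hacc : limit_point (retract (D i) C a) v).
    { apply NNPP. intros Hn. assert (v <= s i); [|order]. apply Hsmax; [|assumption].
      split; [|eauto]. apply nacc_iff. split; [|assumption].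
      left. split; [assumption|]. exists h. split; [assumption|]. split; auto. }
    (* Thus [v] is a limit point of [C a] and equals [h] by minimality, yet then [C a] has points
       between [d] and [h]. *)
    destruct (retract_limit_point (D i) C a v) as [HCv _]; auto.
    destruct (HCcl v Hva HCv) as [HCav _].
    assert (Hhv : h <= v) by auto. assert (v = h) by order. subst v.
    destruct (proj2 HCv d Hlt) as (y & Hy & Hdy & Hyh).
    assert (h <= y); [|order]. apply Hmin. split; [assumption|left; assumption].
Qed.

(* Otherwise some limit [a] in the domain of the J_omega-witnesses has countably many predecessors;
   with [B] all of [a], a regressive [f] can then avoid the countably many [F i], [i < a], one by one. *)
Lemma uncountable_initial_segment S : stationary lt S -> J_omega lt S ->
  exists a, ~ countable (fun b => b < a).
Proof.
  intros HS (C & F & HC & HF). apply NNPP. intros Hno.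
  (* Above the limit [w] every [b] has infinitely many predecessors, too many for the finite set
     [bad b] to exhaust. *)
  destruct (HS _ club_is_limit) as (w & _ & Hw).
  destruct (HS _ (club_inter _ _ HC (club_inter _ _ club_is_limit (club_above w))))
    as (a & Ha & HCa & Hlim & Hwa).
  destruct (NNPP (countable (fun b => b < a))) as [e He]; [eauto|].
  set (bad := fun b x => exists i, (i < a /\ (e i <= e b)%nat) /\ In x (F i b)).
  assert (Hbad : forall b, finite (bad b)).
  { intros b. destruct (finite_level (fun i => i < a) e (e b) He) as [l Hl].
    exists (flat_map (fun i => F i b) l). intros x (i & Hi & Hx). apply in_flat_map. eauto. }
  assert (Hf : forall b, exists v, v <= b /\ (nonzero lt b -> v < b) /\ (w <= b -> ~ bad b v)).
  { intros b. destruct (classic (w <= b)) as [Hwb|Hwb].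
    - destruct (classic (exists v, v < b /\ ~ bad b v)) as [(v & Hvb & Hv)|Hall].
      + exists v. split; [left; assumption|]. auto.
      + destruct (Hbad b) as [l Hl]. destruct (finite_not_limit_point (fun _ => True) w); [|assumption].
        exists l. intros x [_ Hx]. apply Hl. apply NNPP. intros Hb. apply Hall. exists x.
        split; [order|assumption].
    - destruct (classic (nonzero lt b)) as [[z Hz]|Hz].
      + exists z. split; [left; assumption|]. tauto.
      + exists b. split; [right; reflexivity|]. tauto. }
  destruct (choice_of _ Hf) as [f Hfs].
  destruct (HF a Ha HCa f) with (B := fun b => b < a) as (i & Hia & Hsup).
  - intros b Hb. destruct (Hfs b) as (Hfb & _). order.
  - intros b _. apply Hfs.
  - auto.
  - intros g Hg. exists g. split; [assumption|right; reflexivity].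
  - apply is_sup_limit_point in Hsup; [|tauto|apply Hlim].
    apply finite_not_limit_point with (X := fun b => w <= b /\ (b < a /\ In (f b) (F i b))) (a := a).
    (* From [w] on, f(b) can lie in [F i b] only if e(b) <= e(i), that is, for finitely many [b]. *)
    + destruct (finite_level (fun b => b < a) e (e i) He) as [l Hl]. exists l.
      intros b [(Hwb & Hb & Hin) _]. apply Hl. split; [assumption|].
      destruct (Hfs b) as (_ & _ & Hgood).
      destruct (PeanoNat.Nat.le_gt_cases (e b) (e i)) as [|Hlt]; [assumption|].
      destruct (Hgood Hwb). exists i. split; [|assumption]. split; [assumption|lia].
    + apply limit_point_above with w; [assumption|]. intros d Hwd Hda.
      destruct (proj2 Hsup d Hda) as (x & Hx & Hdx & Hxa). exists x.
      split; [|auto]. split; [order|assumption].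
Qed.

End Regular.

(** * Inserting finitely many points into the gaps of a ladder system *)

Definition consecutive (X : K -> Prop) (x y : K) : Prop :=
  X x /\ X y /\ x < y /\ ~ exists z, X z /\ x < z /\ z < y.

(* Finiteness of each [N x y] ensures that the insertions create no new limit points. *)
Definition enrich (N : K -> K -> K -> Prop) (L : K -> K -> Prop) (a v : K) : Prop :=
  L a v \/ exists x y, consecutive (L a) x y /\ N x y v /\ x < v /\ v < y.

(** If [m] bounds [L a] below [g], every new point in (m,g) lies in a gap that starts at or below
    [m] and ends at or above [g]. There is only one such gap, and it receives finitely many
    points. *)
Lemma enrich_limit_point N L a g : (forall x y, finite (N x y)) ->
  limit_point (enrich N L a) g -> limit_point (L a) g.
Proof.
  intros HN Hg. apply NNPP. intros HL.
  destruct (limit_or_max _ g (proj1 Hg) HL) as (m & Hmg & Hm).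
  assert (Hnew : forall v, enrich N L a v -> m < v -> v < g ->
      exists x y, consecutive (L a) x y /\ N x y v /\ x <= m /\ g <= y).
  { intros v [Hv|(x & y & Hxy & Hv & Hxv & Hvy)] Hmv Hvg; [specialize (Hm v Hv Hvg); order|].
    exists x, y. destruct Hxy as (Hx & Hy & Hlt & Hno).
    split; [repeat split; assumption|]. split; [assumption|].
    split; [apply Hm; [assumption|order]|]. apply not_lt. intros Hyg.
    specialize (Hm y Hy Hyg). order. }
  destruct (proj2 Hg m Hmg) as (v0 & Hv0 & Hmv0 & Hv0g).
  destruct (Hnew v0 Hv0 Hmv0 Hv0g) as (x0 & y0 & (Hx0 & Hy0 & Hlt0 & Hno0) & _ & Hx0m & Hgy0).
  apply finite_not_limit_point with (X := N x0 y0) (a := g).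
  - destruct (HN x0 y0) as [l Hl]. exists l. intros v [Hv _]. auto.
  - apply limit_point_above with m; [assumption|]. intros e Hme He.
    destruct (proj2 Hg e He) as (v & Hv & Hev & Hvg).
    destruct (Hnew v Hv) as (x & y & (Hx & Hy & Hlt & Hno) & HNv & Hxm & Hgy); [order|assumption|].
    exists v. split; [|auto].
    assert (x = x0).
    { destruct (lt_total x x0) as [H|[H|H]]; [|assumption|].
      - destruct Hno. exists x0. repeat split; [assumption|assumption|order].
      - destruct Hno0. exists x. repeat split; [assumption|assumption|order]. }
    assert (y = y0).
    { destruct (lt_total y y0) as [H0|[H0|H0]]; [|assumption|].
      - destruct Hno0. exists y. repeat split; [assumption|order|assumption].
      - destruct Hno. exists y0. repeat split; [assumption|order|assumption]. }
    subst. assumption.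
Qed.

Lemma enrich_ladder_system N L : (forall x y, finite (N x y)) ->
  ladder_system L -> ladder_system (enrich N L).
Proof.
  intros HN HL a Ha. destruct (HL a Ha) as (Hsub & Hcof & Hcl). split; [|split].
  - intros v [Hv|(x & y & (_ & Hy & _) & _ & _ & Hvy)]; [auto|]. specialize (Hsub y Hy). order.
  - eapply limit_point_mono; [|exact Hcof]. intros x _ Hx. left. assumption.
  - intros g Hga Hg. apply enrich_limit_point in Hg; [|assumption].
    destruct (Hcl g Hga Hg) as [HLg Heq]. split; [left; assumption|]. intros v. split.
    + intros [Hv|(x & y & (Hx & Hy & Hlt & Hno) & Hv & Hxv & Hvy)].
      * apply Heq in Hv. destruct Hv. split; [left|]; assumption.
      * apply Heq in Hx, Hy. destruct Hx as [Hx Hxg], Hy as [Hy Hyg]. split; [|order].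
        right. exists x, y. split; [|auto]. repeat split; try assumption.
        intros (z & Hz & Hxz & Hzy). apply Hno. exists z. split; [|auto]. apply Heq.
        split; [assumption|order].
    + intros [[Hv|(x & y & (Hx & Hy & Hlt & Hno) & Hv & Hxv & Hvy)] Hvg].
      * left. apply Heq. auto.
      (* A gap of [L a] that starts below the limit point [g] also ends below [g], so it is a gap of
         [L g]. *)
      * assert (Hyg : y < g).
        { apply NNPP. intros Hgy. apply not_lt in Hgy.
          assert (Hxg : x < g) by order.
          destruct (proj2 Hg x Hxg) as (z & Hz & Hxz & Hzg).
          apply Hno. exists z. split; [assumption|]. split; [assumption|order]. }
        right. exists x, y. split; [|auto].
        split; [apply Heq; split; [assumption|order]|].
        split; [apply Heq; split; assumption|]. split; [assumption|].
        intros (z & Hz & Hxz & Hzy). apply Heq in Hz. destruct Hz. apply Hno. eauto.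
Qed.

Lemma enrich_nacc N L a x y v : (forall x y, finite (N x y)) ->
  consecutive (L a) x y -> N x y v -> x < v -> v < y -> nacc lt (enrich N L a) v.
Proof.
  intros HN Hxy Hv Hxv Hvy. apply nacc_iff. split; [right; exists x, y; auto|].
  intros Hlp. apply enrich_limit_point in Hlp; [|assumption].
  destruct (proj2 Hlp x Hxv) as (z & Hz & Hxz & Hzv). apply Hxy. exists z.
  split; [assumption|]. split; [assumption|order].
Qed.

Lemma consecutive_unique X x x' y : consecutive X x y -> consecutive X x' y -> x = x'.
Proof.
  intros (Hx & Hy & Hxy & Hno) (Hx' & _ & Hxy' & Hno').
  destruct (lt_total x x') as [H|[H|H]]; [|assumption|].
  - destruct Hno. eauto.
  - destruct Hno'. eauto.
Qed.

(** The predecessor is the maximum of [L a] below [y], which exists by closure; [m] pushes it as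
    high as desired. *)
Lemma consecutive_exists L a m y : ladder_system L -> is_limit a ->
  L a m -> m < y -> nacc lt (L a) y -> exists x, m <= x /\ consecutive (L a) x y.
Proof.
  intros HL Ha Hm Hmy Hy. apply nacc_iff in Hy. destruct Hy as [Hy Hnl].
  destruct (HL a Ha) as (Hsub & _ & Hcl).
  destruct (limit_or_max (L a) y) as (d & Hdy & Hd); [exists m; assumption|assumption|].
  destruct (last_below_exists (L a) d m) as (x & Hx & Hxd & Hmax).
  - intros g Hgd Hg. refine (proj1 (Hcl g _ Hg)). specialize (Hsub y Hy). order.
  - assumption.
  - auto.
  - exists x. split; [auto|]. split; [assumption|]. split; [assumption|]. split; [order|].
    intros (z & Hz & Hxz & Hzy). assert (z <= x) by auto. order.
Qed.

(** * Coding, and guessing of arbitrary cofinal sets *)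

(** This is where kappa^{<kappa} = kappa enters. [code a] takes total functions but determines only
    their restriction to [a], which avoids dependent domains. *)
Lemma coding_exists : small_powers lt ->
  exists code : K -> (K -> K) -> K,
    forall a g g', code a g = code a g' -> forall i, i < a -> g i = g' i.
Proof.
  intros HP.
  destruct (choice_of (fun a (c : (K -> K) -> K) =>
      forall g g', c g = c g' -> forall i, i < a -> g i = g' i)) as [code Hcode]; [|eauto].
  intros a. destruct (HP a) as [c Hc]. exists (fun g => c (fun i => g (proj1_sig i))).
  intros g g' E i Hi. apply Hc in E. exact (f_equal (fun t => t (exist _ i Hi)) E).
Qed.

End WellOrder.

Theorem theorem4p1 (K : Type) (lt : K -> K -> Prop) :
  strict_well_order lt ->
  is_cardinal lt -> regular lt -> uncountable K ->
  square lt ->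
  small_powers lt ->
  forall S : K -> Prop, stationary lt S -> J_omega lt S -> boxtimes_minus lt S.
Proof.
  intros WO Hcard Hreg Hunc (C & HC & Hno) HP S HS HJ.
  destruct (uncountable_initial_segment lt WO Hcard Hreg Hunc S HS HJ) as [a0 Ha0].
  destruct HJ as (CJ & F & HCJ & HF).
  (* Guessing inside [CJ] makes the J_omega property available at the guessing points. *)
  destruct (club_guessing lt WO Hcard Hreg Hunc C (inter S CJ) a0 HC Hno) as (c & Hc & Hguess);
    [apply stationary_inter; assumption|assumption|].
  destruct (coding_exists lt HP) as [code Hcode].
  (* The guard i < x makes g(i) a function of [code x g], so that finitely many codes yield finitely
     many values. *)
  set (N := fun i x y v => lt i x /\ exists g, In (code x g) (F i y) /\ g i = v).
  assert (HN : forall i x y, finite (N i x y)).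
  { intros i x y.
    destruct (finite_image (fun k v => lt i x /\ exists g, code x g = k /\ g i = v) (F i y)) as [l Hl].
    - intros k v v' (Hi & g & Hg & <-) (_ & g' & Hg' & <-). apply (Hcode x); congruence.
    - exists l. intros v (Hi & g & Hg & Hv). apply Hl. eauto 6. }
  apply NNPP. intros Hbox.
  destruct (choice_of (fun i A => unbounded lt A /\ forall a, S a -> is_limit lt a ->
      ~ limit_point lt (inter (nacc lt (enrich lt (N i) c a)) A) a)) as [A HA].
  { intros i. apply NNPP. intros HnA. apply Hbox.
    assert (Hlad : ladder_system lt (enrich lt (N i) c)) by (apply enrich_ladder_system; auto).
    exists (complete lt (enrich lt (N i) c)). split; [apply complete_coherent; assumption|].
    intros A HA. apply NNPP. intros Hna. apply HnA. exists A. split; [assumption|].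
    intros a HSa Ha Hlp. apply Hna. exists a. split; [assumption|]. split; [apply Ha|].
    apply is_sup_limit_point; [intros x [Hx _]|apply Ha|].
    - apply nacc_iff in Hx. destruct Hx as [Hx _]. apply complete_limit in Hx; [|assumption].
      exact (proj1 (Hlad a Ha) x Hx).
    - eapply limit_point_mono; [|exact Hlp]. intros x _ [Hx HAx]. split; [|assumption].
      eapply nacc_ext; [|exact Hx]. intros v. symmetry. apply complete_limit. assumption. }
  destruct (choice_of (fun p v => A (fst p) v /\ lt (snd p) v)) as [next Hnext].
  { intros [i x]. destruct (unbounded_above lt WO Hreg Hunc (A i) x) as [v Hv]; [apply HA|eauto]. }
  (* One ordinal codes the choices for all j < x at once, before the relevant [i] is known. *)
  set (k := fun x => code x (fun j => next (j, x))).
  destruct (choice_of (fun x u => lt (k x) u /\ forall j, lt j x -> lt (next (j, x)) u)) as [h Hh].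
  { intros x. destruct (bounded_below lt WO Hcard Hreg x (fun j => next (j, x))) as [u Hu].
    destruct (larger_exists lt WO Hreg Hunc (k x) u) as (t & Hkt & Hut). exists t.
    split; [assumption|]. intros j Hj. apply (lt_trans lt WO) with u; auto. }
  set (E := fun y => forall x, lt x y -> lt (h x) y).
  destruct (Hguess E) as (a & [HSa HCJa] & Ha & Hlp).
  { apply club_closure_points; assumption. }
  destruct (Hc a Ha) as (_ & [_ Hcof] & _).
  (* f(y) is the code at the predecessor of [y] in [c a], regressive because y in [E] is closed
     under [h]; elsewhere it is any smaller ordinal, or [y] itself when y = 0. *)
  destruct (choice_of (fun y v => le lt v y /\ (nonzero lt y -> lt v y) /\
      forall x, consecutive lt (c a) x y -> E y -> v = k x)) as [f Hf].
  { intros y. destruct (classic (exists x, consecutive lt (c a) x y /\ E y)) as [(x & Hxy & HE)|Hn].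
    - assert (Hk : lt (k x) y).
      { apply (lt_trans lt WO) with (h x); [apply Hh|]. apply HE. apply Hxy. }
      exists (k x). split; [left; assumption|]. split; [auto|]. intros x' Hx' _. f_equal.
      eapply consecutive_unique; eassumption.
    - destruct (classic (nonzero lt y)) as [[z Hz]|Hz].
      + exists z. split; [left; assumption|]. split; [auto|]. intros x Hx HE. destruct Hn. eauto.
      + exists y. split; [right; reflexivity|]. split; [tauto|]. intros x Hx HE. destruct Hn. eauto. }
  destruct (HF a HSa HCJa f) with (B := fun y => lt y a /\ nacc lt (c a) y /\ E y) as (i & Hia & Hsup).
  - intros b Hb. destruct (proj1 (Hf b)) as [H|H]; [|congruence].
    apply (lt_trans lt WO) with b; assumption.
  - intros b _. apply Hf.
  - tauto.
  - intros g Hg. destruct (proj2 Hlp g Hg) as (y & [Hy HE] & Hgy & Hya). exists y.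
    split; [auto|left; assumption].
  - apply is_sup_limit_point in Hsup; [|tauto|apply Ha].
    apply (proj2 (HA i) a HSa Ha). split; [apply Ha|]. intros d Hd.
    (* A ladder point beyond both [d] and [i]: the predecessor x >= m then satisfies the guard i <
       x, and the inserted point exceeds [d]. *)
    assert (Hm : exists m, c a m /\ lt d m /\ lt i m /\ lt m a).
    { destruct (lt_total lt WO i d) as [Hid|Hid].
      - destruct (Hcof d Hd) as (m & Hm & Hdm & Hma). exists m.
        repeat split; try assumption. apply (lt_trans lt WO) with d; assumption.
      - destruct (Hcof i Hia) as (m & Hm & Him & Hma). exists m.
        repeat split; try assumption. destruct Hid as [<-|Hid]; [assumption|].
        apply (lt_trans lt WO) with i; assumption. }
    destruct Hm as (m & Hm & Hdm & Him & Hma).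
    destruct (proj2 Hsup m Hma) as (y & ((_ & Hy & HE) & HIn) & Hmy & Hya).
    destruct (consecutive_exists lt WO c a m y Hc Ha Hm Hmy Hy) as (x & Hmx & Hxy).
    destruct (Hf y) as (_ & _ & Hfy). rewrite (Hfy x Hxy HE) in HIn.
    assert (Hix : lt i x) by (destruct Hmx as [Hmx|<-]; [apply (lt_trans lt WO) with m|]; assumption).
    assert (Hdx : lt d x) by (destruct Hmx as [Hmx|<-]; [apply (lt_trans lt WO) with m|]; assumption).
    destruct (Hnext (i, x)) as [HAv Hxv]. simpl in HAv, Hxv.
    assert (Hvy : lt (next (i, x)) y).
    { apply (lt_trans lt WO) with (h x); [apply Hh; assumption|]. apply HE. apply Hxy. }
    exists (next (i, x)). split; [split; [|assumption]|].
    (* The code of j |-> next(j,x) lies in [F i y], so its value at [i], a point of [A i], is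
       inserted between [x] and [y]. *)
    + apply enrich_nacc with x y; try assumption; [apply HN|].
      split; [assumption|]. exists (fun j => next (j, x)). auto.
    + split; [apply (lt_trans lt WO) with x; assumption|].
      apply (lt_trans lt WO) with y; assumption.
Qed.
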